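(* $$ \sup_{\varepsilon:\ \varepsilon_J\in[-1,1]}\|T_\varepsilon\|_{L^{1,\infty}}\ =\ \sup_{\varepsilon:\ \varepsilon_J\in\{-1,1\}}\|T_\varepsilon\|_{L^{1,\infty}}, $$ where the suprema are over all families $\varepsilon=\{\varepsilon_J\}_{J\in\mathcal D(I)}$ with the indicated restriction on all the $\varepsilon_J$.
   Context: Let $I=[0,1]$, $\mathcal D(I)$ its dyadic subintervals, and $h_J$ the Haar function equal to $|J|^{-1/2}$ on the right half of $J$, $-|J|^{-1/2}$ on the left half, $0$ off $J$. For a family $\varepsilon=\{\varepsilon_J\}_{J\in\mathcal D(I)}$, the martingale transform is $T_\varepsilon\varphi=\sum_{J\in\mathcal D(I)}\varepsilon_J(\varphi,h_J)h_J$, with $(\cdot,\cdot)$ the $L^2(I)$ scalar product; as throughout the paper, the Haar sums have a finite, unspecified number of terms (i.e. $\varphi$ is a constant plus a finite linear combination of Haar functions). $\|T_\varepsilon\|_{L^{1,\infty}}$ denotes the weak type $(1,1)$ norm of $T_\varepsilon$, i.e. $\sup_{\varphi\ne0}\sup_{\lambda>0}\lambda\,|\{t\in I:|T_\varepsilon\varphi(t)|>\lambda\}|/\|\varphi\|_{L^1(I)}$. *)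

(* Defs.v *)
From mathcomp Require Import all_boot all_order all_algebra.
From mathcomp Require Import all_classical all_reals all_analysis.

Set Implicit Arguments.
Unset Strict Implicit.
Unset Printing Implicit Defensive.

Import Order.TTheory GRing.Theory Num.Theory.
Import numFieldNormedType.Exports.

Local Open Scope classical_set_scope.
Local Open Scope ring_scope.

(* The pair [Tagged _ (k : 'I_(2 ^ n))] of a generation n and a position k
   stands for the dyadic interval of endpoints k / 2^n and (k + 1) / 2^n. *)
Definition dyadic : Type := {n : nat & 'I_(2 ^ n)}.

Section Dyadic.
Variable R : realType.
Implicit Types (J : dyadic) (t : R) (phi : R -> R) (eps : dyadic -> R).

Local Notation mu := (@lebesgue_measure R).

Definition unitI : set R := `[0, 1].

Definition dlen J : R := 2 ^- tag J.

Definition dleft J : R := (tagged J)%:R * dlen J.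

Definition dmid J : R := dleft J + dlen J / 2.

Definition dright J : R := dleft J + dlen J.

(* Half-open halves, so that the two halves of J and the dyadic intervals of
   one generation are disjoint; endpoints only matter up to a null set. *)
Definition haar J t : R :=
  (Num.sqrt (dlen J))^-1 *
  (\1_(`[dmid J, dright J[%classic) t - \1_(`[dleft J, dmid J[%classic) t).

Definition innerI phi (psi : R -> R) : R :=
  \int[mu]_(t in unitI) (phi t * psi t).

Definition haar_poly phi : Prop :=
  exists (c : R) (s : seq dyadic) (a : dyadic -> R),
    phi = fun t => c + \sum_(J <- s) a J * haar J t.

(* The sum over all dyadic intervals is the finitely supported sum of
   fsbigop.v: when phi is a Haar polynomial, only finitely many Haar
   coefficients of phi are nonzero. *)
Definition martingale_transform eps phi t : R :=
  \sum_(J \in [set: dyadic]) (eps J * innerI phi (haar J) * haar J t).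

Definition L1normI phi : \bar R := (\int[mu]_(t in unitI) `|phi t|%:E)%E.

(* phi <> 0 is meant in L^1(I), i.e., phi is not almost everywhere zero. *)
Definition weak_type_norm eps : \bar R :=
  ereal_sup
    [set ereal_sup
      [set (lambda%:E *
            mu [set t | unitI t /\
                  (lambda < `|martingale_transform eps phi t|)%R]
            / L1normI phi)%E
      | lambda in [set lambda : R | 0 < lambda]]
    | phi in [set phi |
        haar_poly phi /\ ~ {ae mu, forall t, unitI t -> phi t = 0}]].

End Dyadic.

(* Main.v *)
Require Import Defs.
From mathcomp Require Import all_boot all_order all_algebra.
From mathcomp Require Import all_classical all_reals all_analysis.
From mathcomp Require Import measurable_realfun ring lra.
Import Order.TTheory GRing.Theory Num.Theory.
Import numFieldNormedType.Exports.
Local Open Scope classical_set_scope.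
Local Open Scope ring_scope.

(** Both suprema are equal to 2.

    Upper bound: if [-1 <= eps J <= 1] for all J, then
    [lambda * |{ |T phi| > lambda }| <= 2 * ||phi||_1].  This is Burkholder's
    method.  Let [U (x, y)] be [y^2 - x^2] on the square [|x| + |y| <= 1] and
    [1 - 2|x|] elsewhere.  Then U has three properties: it majorizes
    [1_{|y| > 1} - 2|x|] ([burkholder_majorant]), it is nonpositive on the axis
    [y = 0] ([burkholder_axis_le0]), and it has at each point a linear
    supergradient valid for all increments [(h, k)] with [|k| <= |h|]
    ([burkholder_supergradient]).  Adding the Haar terms one generation after
    the other, the pair (phi, T phi) moves on each J by [(h, k)] with
    [k = eps J * h], while the supergradient is constant on J.  Hence U of the
    pair is at most its initial value, at [y = 0], plus a linear combination of
    Haar functions ([burkholder_supermartingale]).  The resulting pointwise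
    bound of [1_{|T phi| > lambda}] is integrated, and the Haar functions
    disappear ([haar_weak_bound]).

    Lower bound: a single [phi] with signs [+1, -1, +1] on the generations 0, 1,
    2 suffices.  The pair (phi, T phi) starts at the origin, goes to
    [+-(1/2, 1/2)], then from [(1/2, 1/2)] to [(0, 1)] or [(1, 0)], and finally
    from [(1, 0)] to [(2, 1)] or [(0, -1)] (and symmetrically from
    [(-1/2, -1/2)]).  Each step preserves the mean of U, and the path ends where
    U equals [1_{|y| >= 1} - 2|x|], so nothing is lost: at the end
    [|T phi| = 1] almost everywhere ([extremal_transform_norm]) whereas
    [||phi||_1 = 1/2] ([extremal_fun_norm]).  Letting [lambda] tend to 1 yields
    the ratio 2.

    Families of signs being among those with values in [-1, 1], the two suprema
    lie between 2 and 2. *)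

(** * Burkholder's function *)

Section Burkholder.
Variable R : realFieldType.
Implicit Types x y h k : R.

Definition burkholder (x y : R) : R :=
  if `|x| + `|y| <= 1 then y ^+ 2 - x ^+ 2 else 1 - `|x| *+ 2.

Definition burkholder_dx (x y : R) : R :=
  if `|x| + `|y| <= 1 then - (x *+ 2) else - (Num.sg x *+ 2).

Definition burkholder_dy (x y : R) : R :=
  if `|x| + `|y| <= 1 then y *+ 2 else 0.

Lemma burkholder_majorant x y : (1 < `|y|)%R%:R <= `|x| *+ 2 + burkholder x y.
Proof.
rewrite /burkholder; case: ifPn => [xy1|_]; last first.
  by rewrite addrC subrK lern1 leq_b1.
have y1 : (1 < `|y|) = false by apply: le_gtF; have := normr_ge0 x; lra.
rewrite y1 mulr0n -(real_normK (num_real x)).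
have x1 : `|x| <= 1 by have := normr_ge0 y; lra.
have := normr_ge0 x; have := sqr_ge0 y; nra.
Qed.

Lemma burkholderN x y : burkholder (- x) y = burkholder x y.
Proof. by rewrite /burkholder normrN sqrrN. Qed.

Lemma burkholder_axis_le0 x : burkholder x 0 <= 0.
Proof.
rewrite /burkholder normr0 addr0; case: ifPn; have := sqr_ge0 x; first by lra.
by rewrite -ltNge; lra.
Qed.

(** Outside the square the right-hand side is U itself for [0 <= x]; inside, it
    exceeds U because [|y| <= 1 - |x|].  It gives the supergradient at the
    points outside the square, whatever the increment. *)
Lemma burkholder_le_line x y : burkholder x y <= 1 - x *+ 2.
Proof.
rewrite /burkholder; case: ifPn => [xy|_]; last by have := ler_norm x; lra.
rewrite -(real_normK (num_real y)); have := ler_norm x.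
have := normr_ge0 x; have := normr_ge0 y; nra.
Qed.

(** The right-hand side is the tangent plane at (x, y) of the quadratic piece of
    U, since [2yk - 2xh] is the increment of [y^2 - x^2] plus [h^2 - k^2]: the
    hypothesis [|k| <= |h|] makes the error term favourable.  The content is
    the case where the increment leaves the square. *)
Lemma burkholder_le_parabola x y h k : `|x| + `|y| <= 1 -> `|k| <= `|h| ->
  burkholder (x + h) (y + k) <= (y + k) ^+ 2 - (x + h) ^+ 2 + (h ^+ 2 - k ^+ 2).
Proof.
move=> xy kh.
have kh2 : k ^+ 2 <= h ^+ 2.
  rewrite -(real_normK (num_real k)) -(real_normK (num_real h)).
  by rewrite ler_sqr ?nnegrE.
rewrite /burkholder; case: ifPn => [_|]; first lra.
rewrite -ltNge => out.
(* Outside the square U is [(1 - |x + h|)^2 - (x + h)^2], so that in both cases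
   a bound on [(1 - |x + h|)^2] suffices. *)
have [x1|x1] := lerP `|x + h| 1.
  have : (1 - `|x + h|) ^+ 2 <= (y + k) ^+ 2.
    rewrite -(real_normK (num_real (y + k))) ler_sqr ?nnegrE //; lra.
  rewrite -(real_normK (num_real (x + h))); lra.
have hxy : `|x + h| - 1 <= `|h| - `|y|.
  by have := ler_normD x h; lra.
have : (`|x + h| - 1) ^+ 2 <= (`|h| - `|y|) ^+ 2.
  rewrite ler_sqr ?nnegrE //; lra.
have : - (`|y| * `|h|) <= y * k.
  have : `|y * k| <= `|y| * `|h| by rewrite normrM ler_wpM2l.
  by rewrite ler_norml => /andP[].
have := real_normK (num_real (x + h)); have := real_normK (num_real h).
have := real_normK (num_real y); nra.
Qed.

(** Concavity of U along all directions (h, k) with [|k| <= |h|], and not only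
    along the diagonals [k = +-h]: this is why coefficients inside [-1, 1] do no
    better than signs. *)
Lemma burkholder_supergradient x y h k : `|k| <= `|h| ->
  burkholder (x + h) (y + k) <=
    burkholder x y + burkholder_dx x y * h + burkholder_dy x y * k.
Proof.
move=> kh; rewrite {2}/burkholder /burkholder_dx /burkholder_dy.
case: ifPn => [xy|_].
  by apply: le_trans (burkholder_le_parabola _ _ _ _ xy kh) _; lra.
have [x0|x0|->] := ltrgt0P x.
- by rewrite gtr0_sg //; have := burkholder_le_line (x + h) (y + k); lra.
- rewrite ltr0_sg //.
  by have := burkholder_le_line (- (x + h)) (y + k); rewrite burkholderN; lra.
(* At [x = 0] the two lines of slopes +-2 average to the bound 1. *)
rewrite sgr0 add0r.
have := burkholder_le_line h (y + k).
by have := burkholder_le_line (- h) (y + k); rewrite burkholderN; lra.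
Qed.
End Burkholder.

(** * Haar functions are constant on the smaller dyadic intervals *)

Section Haar.
Variable R : realType.
Implicit Types (J K : dyadic) (t : R) (f g : R -> R) (s : seq dyadic).
Local Notation mu := (@lebesgue_measure R).
Local Notation I01 := (@unitI R).

Lemma dlen_gt0 J : 0 < dlen R J.
Proof. by rewrite invr_gt0 exprn_gt0. Qed.

Lemma haarE J t : haar J t = (Num.sqrt (dlen R J))^-1 *
  ((dmid R J <= t < dright R J)%R%:R - (dleft R J <= t < dmid R J)%R%:R).
Proof. by rewrite /haar !indicE !mem_setE !in_itv. Qed.

Lemma dleft_lt_dmid J : dleft R J < dmid R J.
Proof. by rewrite ltrDl divr_gt0 ?dlen_gt0. Qed.

Lemma dmid_lt_dright J : dmid R J < dright R J.
Proof. by rewrite /dmid /dright; have := dlen_gt0 J; lra. Qed.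

Lemma haar_eq0 J t : ~~ (dleft R J <= t < dright R J) -> haar J t = 0.
Proof.
have := dleft_lt_dmid J; have := dmid_lt_dright J.
rewrite haarE => h1 h2; case: (lerP (dleft R J) t) => h3 //= h4.
  rewrite -leNgt in h4.
  by rewrite (lt_gtF (lt_le_trans h1 h4)) ltNge h4 andbF subrr mulr0.
by rewrite (lt_geF (lt_trans h3 h2)) subrr mulr0.
Qed.

Lemma drightE J : dright R J = (tagged J).+1%:R * 2 ^- tag J.
Proof. by rewrite /dright /dleft /dlen -[in RHS]natr1 mulrDl mul1r. Qed.

(** The endpoints of K are consecutive multiples of [2 ^- tag K], so no multiple
    of the coarser [2 ^- n] lies strictly between them. *)
Lemma grid_le n (j : nat) K t : (n <= tag K)%N -> dleft R K <= t < dright R K ->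
  (j%:R * 2 ^- n <= t) = (j%:R * 2 ^- n <= dleft R K).
Proof.
case: K => m k /= nm /andP[kt tk]; apply/idP/idP => [jt|]; last first.
  by move/le_trans; apply.
have jm : j%:R * 2 ^- n = (j * 2 ^ (m - n))%:R * 2 ^- m :> R.
  rewrite natrM natrX -mulrA; congr (_ * _).
  rewrite -[X in _ * 2 ^- X](subnK nm) exprD invfM mulrA.
  by rewrite divff ?mul1r ?expf_neq0.
move: kt tk jt; rewrite drightE /dleft /dlen /= jm => kt tk jt.
have := le_lt_trans jt tk.
rewrite ler_pM2r ?ltr_pM2r ?invr_gt0 ?exprn_gt0 // ltr_nat ler_nat.
by rewrite ltnS.
Qed.

Lemma dmidE J : dmid R J = (tagged J).*2.+1%:R * 2 ^- (tag J).+1.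
Proof.
rewrite /dmid /dleft /dlen -[in RHS]natr1 -muln2 natrM exprSr.
by rewrite invfM mulrDl mul1r [2 ^- _ / 2]mulrC mulrA mulfK //.
Qed.

(** For a strictly coarser J, the three breakpoints of [haar J] lie on the grid
    of K; for another J of the same generation, [haar J] vanishes on K. *)
Lemma haar_const J K t : (tag J <= tag K)%N -> J != K ->
  dleft R K <= t < dright R K -> haar J t = haar J (dleft R K).
Proof.
have Kdl : dleft R K <= dleft R K < dright R K.
  by rewrite lexx (lt_trans (dleft_lt_dmid K) (dmid_lt_dright K)).
rewrite leq_eqVlt => /orP[/eqP tJK JK Kt|tJK _ Kt]; last first.
  have gl : (dleft R J <= t) = (dleft R J <= dleft R K).
    exact: grid_le (ltnW tJK) Kt.
  have gm : (dmid R J <= t) = (dmid R J <= dleft R K).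
    by rewrite dmidE; exact: grid_le tJK Kt.
  have gr : (dright R J <= t) = (dright R J <= dleft R K).
    by rewrite drightE; exact: grid_le (ltnW tJK) Kt.
  by rewrite !haarE !(ltNge t) !(ltNge (dleft R K)) gl gm gr.
suff H u : dleft R K <= u < dright R K -> haar J u = 0 by rewrite !H.
move=> Ku; apply: haar_eq0; apply/negP => Ju; move/eqP: JK; apply.
have l1 : dleft R J <= dleft R K.
  by rewrite -(@grid_le _ (tagged J) K u) // ?tJK //; case/andP: Ju.
have l2 : dleft R K <= dleft R J.
  by rewrite -(@grid_le _ (tagged K) J u) // ?tJK //; case/andP: Ku.
have {l1 l2} : dleft R J = dleft R K by apply/eqP; rewrite eq_le l1 l2.
case: J K {Ku Ju Kt Kdl} tJK => n j [m k] /= tJK.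
(* The generations are identified to put both positions in one ordinal type. *)
case: _ / tJK k => k.
rewrite /dleft /dlen /= => /(mulIf _) jk; congr (existT _ _ _).
apply: val_inj; apply/eqP; rewrite -(eqr_nat R) jk //.
Qed.

Lemma haar_mul J K t : (tag J <= tag K)%N -> J != K ->
  haar J t * haar K t = haar J (dleft R K) * haar K t.
Proof.
move=> tJK JK; have [Kt|Kt] := boolP (dleft R K <= t < dright R K).
  by rewrite (haar_const _ _ _ tJK JK Kt).
by rewrite (haar_eq0 K t) ?mulr0.
Qed.

Lemma haar_sqr J t :
  haar J t * haar J t = (dlen R J)^-1 * \1_(`[dleft R J, dright R J[%classic) t.
Proof.
rewrite indicE mem_setE in_itv /= haarE mulrACA -invfM -expr2 sqr_sqrtr; last first.
  exact/ltW/dlen_gt0.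
congr (_ * _); have := dleft_lt_dmid J; have := dmid_lt_dright J.
case: (lerP (dleft R J) t); case: (lerP (dmid R J) t);
  case: (ltrP t (dright R J)) => //=; rewrite ?(mulr0n, mulr1n); lra.
Qed.

(** * Integrals over the unit interval *)

Lemma lebesgue_measure_unitI : mu I01 = 1%E.
Proof. by rewrite lebesgue_measure_itv /= lte_fin ltr01 oppr0 adde0. Qed.

(** Integrability and value are bundled so that linearity applies to both at
    once. *)
Definition has_integral f (v : R) :=
  mu.-integrable I01 (EFin \o f) /\ \int[mu]_(t in I01) f t = v.

Lemma measurable_unitI : measurable I01.
Proof. exact: measurable_itv. Qed.
#[local] Hint Resolve measurable_unitI : core.

Lemma has_integralD f g u v : has_integral f u -> has_integral g v ->
  has_integral (fun t => f t + g t) (u + v).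
Proof.
move=> [fi <-] [gi <-]; split; last by rewrite RintegralD.
rewrite (_ : EFin \o _ = (EFin \o f) \+ (EFin \o g))%E //.
exact: integrableD.
Qed.

Lemma has_integralZ f v r : has_integral f v ->
  has_integral (fun t => r * f t) (r * v).
Proof.
move=> [fi <-]; split; last by rewrite RintegralZl.
rewrite (_ : EFin \o _ = (fun t => r%:E * (EFin \o f) t)%E) //.
exact: integrableZl.
Qed.

Lemma has_integral_sum s (F : dyadic -> R -> R) (v : dyadic -> R) :
  (forall J, has_integral (F J) (v J)) ->
  has_integral (fun t => \sum_(J <- s) F J t) (\sum_(J <- s) v J).
Proof.
move=> Fv; elim: s => [|J s IH].
  rewrite big_nil; under eq_fun do rewrite big_nil.
  by split; [exact: integrable0|rewrite Rintegral_cst // mul0r].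
rewrite big_cons; under eq_fun do rewrite big_cons.
exact: has_integralD.
Qed.

Lemma has_integral_norm f v : has_integral f v ->
  has_integral (fun t => `|f t|) (\int[mu]_(t in I01) `|f t|).
Proof.
move=> [fi _]; split => //.
by rewrite (_ : EFin \o _ = abse \o (EFin \o f)) //; apply: integrable_abse.
Qed.

Lemma has_integral_le f g u v : has_integral f u -> has_integral g v ->
  (forall t, f t <= g t) -> u <= v.
Proof. by move=> [fi <-] [gi <-] fg; apply: le_Rintegral. Qed.

Lemma has_integral_indic (A : set R) : measurable A ->
  has_integral (\1_A) (fine (mu (A `&` I01))).
Proof.
move=> mA; split; last by rewrite /Rintegral integral_indic.
apply: measurable_bounded_integrable => //.
- have : (mu I01 < +oo)%E by rewrite lebesgue_measure_unitI ltry.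
  exact.
exists 1; split; [exact: num_real|] => M M1 t _ /=; rewrite indicE.
by apply: le_trans (ltW M1); rewrite normr_nat lern1 leq_b1.
Qed.

Lemma has_integral_cst c : has_integral (fun=> c) c.
Proof.
have := has_integralZ _ _ c (has_integral_indic _ (@measurableT _ R)).
rewrite setTI lebesgue_measure_unitI /= mulr1.
by under eq_fun do rewrite indicT mulr1.
Qed.

Lemma has_integral_itv (a b : R) : 0 <= a -> a <= b -> b <= 1 ->
  has_integral (\1_(`[a, b[%classic)) (b - a).
Proof.
move=> a0 ab b1; have := has_integral_indic _ (measurable_itv `[a, b[).
rewrite setIidl; last first.
  move=> t /=; rewrite /unitI /= !in_itv /= => /andP[]; lra.
rewrite lebesgue_measure_itv /= lte_fin; case: ltrP => //= ba.
have -> : b = a by apply/eqP; rewrite eq_le ab ba.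
by rewrite subrr.
Qed.

(** * Orthonormality and the transform of a Haar polynomial *)

Lemma dleft_ge0 J : 0 <= dleft R J.
Proof. by rewrite mulr_ge0 // ltW // dlen_gt0. Qed.

Lemma dright_le1 J : dright R J <= 1.
Proof.
rewrite drightE ler_pdivrMr ?exprn_gt0 // mul1r -natrX ler_nat.
exact: ltn_ord.
Qed.

Lemma has_integral_haar J : has_integral (haar J) 0.
Proof.
have h1 := dleft_lt_dmid J; have h2 := dmid_lt_dright J.
have h3 := dleft_ge0 J; have h4 := dright_le1 J.
pose I1 := has_integral_itv (dmid R J) (dright R J) ltac:(lra) (ltW h2) h4.
pose I2 := has_integral_itv (dleft R J) (dmid R J) h3 (ltW h1) ltac:(lra).
have := has_integralZ _ _ (Num.sqrt (dlen R J))^-1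
  (has_integralD _ _ _ _ I1 (has_integralZ _ _ (-1) I2)).
under eq_fun do rewrite mulN1r.
rewrite [X in has_integral _ (_ * X)](_ : _ = 0) ?mulr0 //.
by rewrite /dmid /dright; field.
Qed.

(** On the finer of two distinct intervals the coarser Haar function is a
    constant, which reduces the product to a multiple of one Haar function. *)
Lemma has_integral_haarM J K :
  has_integral (fun t => haar J t * haar K t) (J == K)%:R.
Proof.
wlog tJK : J K / (tag J <= tag K)%N => [H|].
  have [|/ltnW] := leqP (tag J) (tag K); first exact: H.
  by move/H; rewrite eq_sym; under eq_fun do rewrite mulrC.
have [<-|JK] := eqVneq J K.
  under eq_fun do rewrite haar_sqr.
  have h1 := dleft_lt_dmid J; have h2 := dmid_lt_dright J.
  have := has_integralZ _ _ (dlen R J)^-1 (has_integral_itv _ _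
     (dleft_ge0 J) (ltW (lt_trans h1 h2)) (dright_le1 J)).
  by rewrite {2}/dright addrAC subrr add0r mulVf // gt_eqF // dlen_gt0.
under eq_fun do rewrite haar_mul//.
have := has_integralZ _ _ (haar J (dleft R K)) (has_integral_haar K).
by rewrite mulr0.
Qed.

Lemma haar_coeff c s (a : dyadic -> R) K : uniq s ->
  innerI (fun t => c + \sum_(J <- s) a J * haar J t) (haar K) =
  if K \in s then a K else 0.
Proof.
move=> us; have : has_integral
    (fun t => (c + \sum_(J <- s) a J * haar J t) * haar K t)
    (\sum_(J <- s) a J * (J == K)%:R).
  under eq_fun do rewrite mulrDl mulr_suml.
  rewrite -[X in has_integral _ X]add0r.
  apply: has_integralD.
    by have := has_integralZ _ _ c (has_integral_haar K); rewrite mulr0.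
  apply: (has_integral_sum s (fun J t => a J * haar J t * haar K t)) => J.
  under eq_fun do rewrite -mulrA.
  exact: has_integralZ (has_integral_haarM J K).
move=> [_]; rewrite /innerI => ->.
case: ifPn => Ks.
  rewrite (bigD1_seq K) //= eqxx mulr1 big1 ?addr0 // => J /negbTE ->.
  by rewrite mulr0.
rewrite big1_seq // => J /= Js; case: eqVneq => [JK|]; last by rewrite mulr0.
by rewrite JK (negbTE Ks) in Js.
Qed.

Lemma martingale_transformE eps c s (a : dyadic -> R) : uniq s ->
  martingale_transform eps (fun t => c + \sum_(J <- s) a J * haar J t) =
  fun t => \sum_(J <- s) eps J * a J * haar J t.
Proof.
move=> us; apply/funext => t; rewrite /martingale_transform.
rewrite (fsbigE s) //=; last first.
  by move=> J _ /negbTE Js; rewrite haar_coeff // Js mulr0 mul0r.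
rewrite big_seq_cond [RHS]big_seq; apply: eq_big => J.
  by rewrite in_setT andbT.
by move=> /andP[Js _]; rewrite haar_coeff // Js.
Qed.

(** Duplicates are merged because [martingale_transformE] needs distinct
    intervals; generations are sorted so that the partial sums form a
    martingale. *)
Lemma haar_poly_normal (phi : R -> R) : haar_poly phi ->
  exists c s (a : dyadic -> R), [/\ uniq s,
    pairwise (fun J K => tag J <= tag K)%N s &
    phi = fun t => c + \sum_(J <- s) a J * haar J t].
Proof.
move=> [c [s [a ->]]].
pose leT := fun J K : dyadic => (tag J <= tag K)%N.
have tot : total leT by move=> J K; apply: leq_total.
have tr : transitive leT by move=> J K L; apply: leq_trans.
exists c, (sort leT (undup s)), (fun J => a J *+ count_mem J s); split.
- by rewrite sort_uniq undup_uniq.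
- by rewrite -sorted_pairwise // sort_sorted.
apply/funext => t; congr (_ + _).
rewrite (perm_big _ (permEl (perm_sort leT _))) /=.
rewrite -big_undup_iterop_count; apply: eq_bigr => J _.
by rewrite mulrnAl.
Qed.

(** * The upper bound *)

(** When the term of J is added, the pair of earlier partial sums is constant on
    J, equal to its value [(f0, g0)] at the left endpoint.  So the supergradient
    inequality costs a constant multiple D of [haar J]. *)
Lemma burkholder_supermartingale c s (a e : dyadic -> R) :
  uniq s -> pairwise (fun J K => tag J <= tag K)%N s ->
  (forall J, `|e J| <= 1) ->
  exists d : dyadic -> R, forall t,
    burkholder _ (c + \sum_(J <- s) a J * haar J t)
        (\sum_(J <- s) e J * a J * haar J t)
      <= burkholder _ c 0 + \sum_(J <- s) d J * haar J t.
Proof.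
move=> us ps e1; elim/last_ind: s us ps => [|s J IH].
  by exists (fun=> 0) => t; rewrite !big_nil !addr0.
rewrite rcons_uniq pairwise_rcons => /andP[Js us] /andP[/allP sJ ps].
have [d dP] := IH us ps.
pose f0 := c + \sum_(K <- s) a K * haar K (dleft R J).
pose g0 := \sum_(K <- s) e K * a K * haar K (dleft R J).
pose D := burkholder_dx _ f0 g0 * a J + burkholder_dy _ f0 g0 * (e J * a J).
exists (fun K => if K == J then D else d K) => t.
rewrite -cats1 !big_cat !big_seq1 /= !addrA.
have -> : \sum_(K <- s) (if K == J then D else d K) * haar K t =
    \sum_(K <- s) d K * haar K t.
  apply: eq_big_seq => K Ks; case: eqP => // KJ.
  by rewrite -KJ Ks in Js.
rewrite eqxx; have [Jt|Jt] := boolP (dleft R J <= t < dright R J); last first.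
  by rewrite !(haar_eq0 J t) // !mulr0 !addr0.
have cst K : K \in s -> haar K t = haar K (dleft R J).
  move=> Ks; apply: haar_const Jt; first exact: sJ.
  by apply: contraNneq Js => <-.
have := dP t.
have -> : c + \sum_(K <- s) a K * haar K t = f0.
  by congr (_ + _); apply: eq_big_seq => K /cst ->.
have -> : \sum_(K <- s) e K * a K * haar K t = g0.
  by apply: eq_big_seq => K /cst ->.
have kh : `|e J * a J * haar J t| <= `|a J * haar J t|.
  by rewrite -mulrA normrM ler_piMl.
have := burkholder_supergradient _ f0 g0 _ _ kh.
rewrite /D; lra.
Qed.

Lemma has_integral_haar_poly c s (a : dyadic -> R) :
  has_integral (fun t => c + \sum_(J <- s) a J * haar J t) c.
Proof.
rewrite -[X in has_integral _ X]addr0; apply: has_integralD.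
  exact: has_integral_cst.
rewrite [X in has_integral _ X](_ : 0 = \sum_(J <- s) 0); last by rewrite big1_eq.
apply: (has_integral_sum s (fun J t => a J * haar J t) (fun=> 0)) => J.
by have := has_integralZ _ _ (a J) (has_integral_haar J); rewrite mulr0.
Qed.

Lemma L1normI_has_integral f v : has_integral (fun t => `|f t|) v ->
  L1normI f = v%:E.
Proof.
move=> [fi <-]; rewrite /Rintegral fineK //.
exact: integrable_fin_num.
Qed.

Lemma L1normI_eq0 f v : has_integral f v ->
  L1normI f = 0%E <-> {ae mu, forall t, I01 t -> f t = 0}.
Proof.
move=> [/measurable_int mf _].
rewrite /L1normI (ae_eq_integral_abs mu measurable_unitI mf).
have aeF : Filter (almost_everywhere mu) := ae_filter_ringOfSetsType mu.
split; apply: (@filterS _ _ aeF) => t H It; first by case: (H It).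
by rewrite /= (H It).
Qed.

Lemma measurable_superlevel g v (l : R) : has_integral g v ->
  measurable [set t | I01 t /\ (l < `|g t|)%R].
Proof.
move=> [/measurable_int/measurable_EFinP mg _].
have -> : [set t | I01 t /\ (l < `|g t|)%R] =
    I01 `&` (Num.norm \o g) @^-1` `]l, +oo[.
  by apply/seteqP; split => t /=; rewrite in_itv /= andbT.
exact: (measurableT_comp (@normr_measurable R setT) mg) (measurable_itv _).
Qed.

(** By homogeneity [f] and [g] are divided by [l], so that the level becomes 1.
    In the pointwise bound all terms but [|f|] are Haar functions, whose
    integral is 0. *)
Lemma haar_weak_bound c s (a e : dyadic -> R) (l : R) :
  uniq s -> pairwise (fun J K => tag J <= tag K)%N s ->
  (forall J, `|e J| <= 1) -> 0 < l ->
  let f t := c + \sum_(J <- s) a J * haar J t in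
  let g t := \sum_(J <- s) e J * a J * haar J t in
  exists2 m : R, mu [set t | I01 t /\ (l < `|g t|)%R] = m%:E &
    l * m <= 2 * \int[mu]_(t in I01) `|f t|.
Proof.
move=> us ps e1 l0 f g.
have fI : has_integral f c by exact: has_integral_haar_poly.
have gI : has_integral g 0.
  have := has_integral_haar_poly 0 s (fun J => e J * a J).
  by under eq_fun do rewrite add0r.
pose A := [set t | I01 t /\ (l < `|g t|)%R].
have mA : measurable A := measurable_superlevel _ _ l gI.
have AI : mu (A `&` I01) = mu A.
  by congr (mu _); apply/seteqP; split => [t []|t /[dup] -[]].
have Afin : mu A \is a fin_num.
  rewrite ge0_fin_numE ?measure_ge0 //.
  apply: (@le_lt_trans _ _ (mu I01)).
    by apply: le_measure; rewrite ?inE // => t [].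
  by rewrite lebesgue_measure_unitI ltry.
exists (fine (mu A)); first by rewrite fineK.
have [d dP] :=
  burkholder_supermartingale (c / l) s (fun J => a J / l) e us ps e1.
have ind_le t : \1_A t <= 2 / l * `|f t| + (0 + \sum_(J <- s) d J * haar J t).
  have fE : c / l + \sum_(J <- s) a J / l * haar J t = l^-1 * f t.
    rewrite /f mulrDr mulr_sumr mulrC; congr (_ + _).
    by apply: eq_bigr => J _; rewrite mulrAC mulrC.
  have gE : \sum_(J <- s) e J * (a J / l) * haar J t = l^-1 * g t.
    rewrite /g mulr_sumr; apply: eq_bigr => J _.
    by rewrite mulrA mulrAC mulrC.
  have := dP t; rewrite fE gE; have := burkholder_axis_le0 _ (c / l).
  have := burkholder_majorant _ (l^-1 * f t) (l^-1 * g t).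
  rewrite !normrM (gtr0_norm (_ : 0 < l^-1)) ?invr_gt0 //.
  rewrite -[X in (X < _)%R](mulVf (lt0r_neq0 l0)) ltr_pM2l ?invr_gt0 //.
  have : \1_A t <= (l < `|g t|)%R%:R :> R.
    rewrite indicE; case: (boolP (t \in A)) => [|_]; last by rewrite ler0n.
    by rewrite inE => -[_ ->].
  by rewrite add0r; lra.
have := has_integral_le _ _ _ _ (has_integral_indic _ mA)
  (has_integralD _ _ _ _ (has_integralZ _ _ (2 / l) (has_integral_norm _ _ fI))
     (has_integral_haar_poly 0 s d)) ind_le.
rewrite AI addr0 mulrAC ler_pdivlMr // mulrC; exact.
Qed.

Lemma weak_type_norm_le2 (eps : dyadic -> R) :
  (forall J, -1 <= eps J <= 1) -> (weak_type_norm eps <= 2%:E)%E.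
Proof.
move=> eps1; apply: ge_ereal_sup => _ [phi [phiP phi0] <-].
apply: ge_ereal_sup => _ [l /= l0 <-].
have [c [s [a [us ps phiE]]]] := haar_poly_normal _ phiP.
subst phi; have phiI := has_integral_haar_poly c s a.
have nI := has_integral_norm _ _ phiI.
have nE := L1normI_has_integral _ _ nI.
have e1 J : `|eps J| <= 1 by rewrite ler_norml.
have [m] := haar_weak_bound c s a eps l us ps e1 l0.
rewrite martingale_transformE // => -> ml.
have L0 : 0 < \int[mu]_(t in I01) `|c + \sum_(J <- s) a J * haar J t|.
  rewrite lt0r Rintegral_ge0 // andbT; apply/eqP => n0; apply: phi0.
  by apply/(L1normI_eq0 _ _ phiI); rewrite nE n0.
by rewrite nE inver (gt_eqF L0) -!EFinM lee_fin ler_pdivrMr.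
Qed.

(** * An extremal function for the lower bound *)

(** The steps of the extremal path: only the first and last quarters need a
    third step, the path having already reached [|y| = 1] on the other two. *)
Definition extremal_seq : seq dyadic :=
  [:: Tagged (fun n => 'I_(2 ^ n)) (@Ordinal (2 ^ 0) 0 erefl);
      Tagged (fun n => 'I_(2 ^ n)) (@Ordinal (2 ^ 1) 0 erefl);
      Tagged (fun n => 'I_(2 ^ n)) (@Ordinal (2 ^ 1) 1 erefl);
      Tagged (fun n => 'I_(2 ^ n)) (@Ordinal (2 ^ 2) 0 erefl);
      Tagged (fun n => 'I_(2 ^ n)) (@Ordinal (2 ^ 2) 3 erefl)].

(** Comparing generations and positions as numbers makes the test compute. *)
Lemma extremal_seq_uniq : uniq extremal_seq.
Proof. exact: (@map_uniq _ _ (fun J => (tag J, val (tagged J)))). Qed.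

(** The factor [Num.sqrt (dlen R J)] cancels the normalization of [haar J]: the
    jumps are +-1/2 in generations 0 and 1, and +-1 in generation 2. *)
Definition extremal_amp J : R :=
  (if tag J == 2%N then 1 else 2^-1) * Num.sqrt (dlen R J).

(** Almost everywhere, this is 2 on [7/8, 1], -2 on [0, 1/8] and 0 elsewhere. *)
Definition extremal_fun t : R :=
  0 + \sum_(J <- extremal_seq) extremal_amp J * haar J t.

Definition extremal_sign J : R := (-1) ^+ tag J.

Lemma extremal_ampE J t : extremal_amp J * haar J t =
  (if tag J == 2%N then 1 else 2^-1) *
  ((dmid R J <= t < dright R J)%R%:R - (dleft R J <= t < dmid R J)%R%:R).
Proof.
rewrite haarE /extremal_amp -mulrA; congr (_ * _).
by rewrite mulrA divff ?mul1r // gt_eqF // sqrtr_gt0 dlen_gt0.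
Qed.

Lemma extremal_breakpointsE :
  (2^-1 / 2 = 4^-1 :> R) * (2^-1 + 4^-1 = 3/4 :> R) *
  (2^-1 + 2^-1 = 1 :> R) * (4^-1 / 2 = 8^-1 :> R) * (2^-2 = 4^-1 :> R) *
  (3/2^+2 = 3/4 :> R) * (3/4 + 8^-1 = 7/8 :> R) * (3/4 + 4^-1 = 1 :> R).
Proof. by do !split; field. Qed.

(** The breakpoints of the five Haar functions, 0 and 1 included, cut the line
    into cells, on each of which all the comparisons have a fixed value. *)
Ltac split_cells t :=
  case: (lerP 0 t) => ?; case: (lerP (8^-1) t) => ?; try (exfalso; lra);
  case: (lerP (4^-1) t) => ?; try (exfalso; lra);
  case: (lerP (2^-1) t) => ?; try (exfalso; lra);
  case: (lerP (3/4) t) => ?; try (exfalso; lra);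
  case: (lerP (7/8) t) => ?; try (exfalso; lra);
  case: (lerP 1 t) => ?; try (exfalso; lra);
  rewrite /= ?(mulr0n, mulr1n).

Lemma extremal_fun_norm t : `|extremal_fun t| =
  2 * \1_(`[0, 8^-1[%classic) t + 2 * \1_(`[7/8, 1[%classic) t.
Proof.
rewrite /extremal_fun /extremal_seq !big_cons big_nil !extremal_ampE.
rewrite /dright /dmid /dleft /dlen /=.
rewrite !indicE !mem_setE !in_itv /=.
rewrite !(expr0, expr1, invr1, mul0r, mul1r, add0r, addr0).
rewrite !extremal_breakpointsE.
by split_cells t; first [rewrite ger0_norm; lra|rewrite ler0_norm; lra].
Qed.

Lemma extremal_transform_norm t : 0 <= t < 1 ->
  `|martingale_transform extremal_sign extremal_fun t| = 1.
Proof.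
move=> t01; rewrite (martingale_transformE _ _ _ _ extremal_seq_uniq).
under eq_bigr do rewrite -mulrA extremal_ampE.
rewrite /extremal_seq !big_cons big_nil.
rewrite /dright /dmid /dleft /dlen /extremal_sign /=.
rewrite !(expr0, expr1, invr1, mul0r, mul1r, add0r, addr0).
rewrite !extremal_breakpointsE.
move: t01.
by split_cells t => // _; first [rewrite ger0_norm; lra|rewrite ler0_norm; lra].
Qed.

Lemma weak_type_norm_extremal_ge2 : (2%:E <= weak_type_norm extremal_sign)%E.
Proof.
have nE : L1normI extremal_fun = (1/2)%:E.
  rewrite (_ : 1/2 = 2 * (8^-1 - 0) + 2 * (1 - 7/8)); last by lra.
  apply: L1normI_has_integral; under eq_fun do rewrite extremal_fun_norm.
  by apply: has_integralD; apply: has_integralZ; apply: has_integral_itv; lra.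
apply/lee_addgt0Pr => e e0.
(* The level is close to 1, the common value of [|T phi|]. *)
pose l : R := Num.max (1/2) (1 - e / 2).
have l0 : 0 < l by rewrite lt_max; apply/orP; left; lra.
have l1 : l < 1 by rewrite gt_max; apply/andP; split; lra.
have le2 : 2 - e <= 2 * l.
  have : 1 - e / 2 <= l by rewrite le_max lexx orbT.
  lra.
rewrite -leeBlDr // -EFinB.
apply: (@le_trans _ _ (2 * l)%:E); first by rewrite lee_fin.
have phiP : haar_poly extremal_fun by exists 0, extremal_seq, extremal_amp.
have phi0 : ~ {ae mu, forall t, I01 t -> extremal_fun t = 0}.
  have extI := has_integral_haar_poly 0 extremal_seq extremal_amp.
  move=> /(L1normI_eq0 _ _ extI); rewrite -/(extremal_fun) nE => -[]; lra.
apply: le_trans; last first.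
  by apply: ereal_sup_ubound; exists extremal_fun.
apply: le_trans; last first.
  by apply: ereal_sup_ubound; exists l.
rewrite nE inver gt_eqF; last by lra.
rewrite -muleA [X in (_ * X)%E]muleC muleA -EFinM.
rewrite (_ : l * (1 / 2)^-1 = 2 * l); last by field.
set A := [set t | _].
rewrite -[leLHS]mule1; apply: lee_wpmul2l; first by rewrite lee_fin; lra.
have -> : 1%E = mu `[0, 1[%classic.
  by rewrite lebesgue_measure_itv /= lte_fin ltr01 oppr0 adde0.
apply: le_measure; rewrite ?inE.
- exact: measurable_itv.
- rewrite /A (martingale_transformE _ _ _ _ extremal_seq_uniq).
  have := has_integral_haar_poly 0 extremal_seq
    (fun J => extremal_sign J * extremal_amp J).
  under eq_fun do rewrite add0r.
  exact: measurable_superlevel.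
- move=> t; rewrite /= in_itv => /= t01.
  by split; rewrite ?extremal_transform_norm // /unitI /= in_itv /=; lra.
Qed.
End Haar.

Theorem corollary2p7 (R : realType) :
  ereal_sup [set weak_type_norm eps | eps in
    [set eps : dyadic -> R | forall J : dyadic, -1 <= eps J <= 1]]
  = ereal_sup [set weak_type_norm eps | eps in
    [set eps : dyadic -> R | forall J : dyadic, eps J = -1 \/ eps J = 1]].
Proof.
apply/eqP; rewrite eq_le; apply/andP; split; last first.
  apply: ereal_sup_le => _ [eps epsP <-].
  by exists eps => // J; case: (epsP J) => ->; lra.
apply: (@le_trans _ _ 2%:E).
  by apply: ge_ereal_sup => _ [eps epsP <-]; exact: weak_type_norm_le2.
apply: le_trans (weak_type_norm_extremal_ge2 R) _.
apply: ereal_sup_ubound; exists (extremal_sign R) => // J.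
by rewrite /extremal_sign -signr_odd; case: (odd _); [left|right].
Qed.
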